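(* Let $G$ be a group acting on a locally finite tree $T$, without edge inversions, where $T$ has at least one edge, the stabilisers in $G$ of any two adjacent vertices are incomparable with respect to inclusion, and the quotient graph $G\backslash T$ is finite. Assume that the action $(G,T)$ is weakly locally $\infty$-transitive or (P)-closed. Then, for all $t_1,t_2\in T=VT\sqcup ET$, the following are equivalent: (i) $(G,G_{t_1},G_{t_2})$ has the double-coset property; (ii) $(G,G_{t_1},G_{t_2})$ has polynomial double-coset growth; (iii) for every $e\in ET$, $G_e$ is not contained in any end stabiliser, i.e. $G_e\not\subseteq G_\xi$ for every end $\xi$ of $T$.
   Context: Graphs are in the sense of Serre: $\Gamma=V\Gamma\sqcup E\Gamma$ with maps $o,t\colon E\Gamma\to V\Gamma$ and a fixed-point-free involution $e\mapsto\bar e$ on $E\Gamma$ with $o(\bar e)=t(e)$. A path is either a trivial path at a vertex (length $0$) or a sequence of edges $(e_1,\dots,e_n)$ with $t(e_i)=o(e_{i+1})$ (repetitions and backtracking allowed); it is reduced if $e_{i+1}\ne\bar e_i$ for all $i$. In a tree, reduced paths are called geodesics. An action on $T$ is a continuous homomorphism $G\to\mathrm{Aut}(T)$, where $\mathrm{Aut}(T)$ has the permutation topology (pointwise stabilisers of finite sets form a basis at $1$). Without edge inversions: $g\cdot e\neq\bar e$ for all $g\in G$, $e\in ET$. $G_t$ is the stabiliser of $t\in T$. The quotient graph $G\backslash T$ has vertex set $G\backslash VT$ and edge set $G\backslash ET$, and $\pi\colon T\to G\backslash T$ is the quotient map, extended entrywise to paths. Weakly locally $\infty$-transitive: for every $v\in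 VT$ and every path $\mathfrak p$ in $G\backslash T$ starting at $\pi(v)$, $G_v$ acts transitively on the set of geodesics $\tilde{\mathfrak p}$ in $T$ starting at $v$ with $\pi(\tilde{\mathfrak p})=\mathfrak p$. Tits' property (P): for a geodesic or ray $\ell$ in $T$ with vertices $(v_n)_{n\ge0}$, let $\pi_\ell\colon VT\to\{v_n\}$ be the closest point projection; the pointwise stabiliser $G_\ell$ induces a permutation group $(G_\ell)_n$ on each $\pi_\ell^{-1}(v_n)$; property (P) says that the natural injective map $G_\ell\to\prod_n(G_\ell)_n$ is surjective for every such $\ell$. The action is (P)-closed if $G\le\mathrm{Aut}(T)$ is a closed subgroup and $(G,T)$ has Tits' property (P). A ray is an infinite sequence of edges $(e_i)_{i\ge1}$ with $t(e_i)=o(e_{i+1})$ and pairwise distinct origins; ends are classes of rays under the usual equivalence (eventually coinciding); $G_\xi$ is the setwise stabiliser of the end $\xi$. For a group $G$ and subgroups $H,K$ with $|HgK/K|<\infty$ for all $g$, let $a_n(G,H,K)=|\{HgK\in H\backslash G/K: |HgK/K|=n\}|$, $n\ge1$. $(G,H,K)$ has the double-coset property if $a_n(G,H,K)<\infty$ for all $n\ge1$, and polynomial double-coset growth if there is $\alpha\in\mathbb R_{\ge0}$ with $a_n(G,H,K)=O(n^\alpha)$. *)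

(* Defs.v *)
From HB Require Import structures.
From mathcomp Require Import all_boot all_order all_algebra.
From mathcomp Require Import finmap.
From mathcomp Require Import all_classical all_reals all_analysis.
From Stdlib Require List.
Import Order.TTheory GRing.Theory Num.Theory.
Import numFieldNormedType.Exports.

Set Implicit Arguments.
Unset Strict Implicit.
Unset Printing Implicit Defensive.

Local Open Scope classical_set_scope.

(* Topological groups; no separation axiom is assumed. *)
HB.mixin Record Group_isTopologicalGroup G & Group G & Topological G := {
  mulg_continuous : continuous (fun xy : G * G => (xy.1 * xy.2)%g);
  invg_continuous : continuous (fun x : G => (x^-1)%g)
}.

#[short(type="topologicalGroupType")]
HB.structure Definition TopologicalGroup :=
  {G of Group G & Topological G & Group_isTopologicalGroup G}.

(* Graphs in the sense of Serre: every geometric edge is a pair {e, bar e}. *)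
Record sgraph := SGraph {
  vertex : Type;
  edge : Type;
  org : edge -> vertex;
  tgt : edge -> vertex;
  bar : edge -> edge;
  barK : involutive bar;
  bar_neq : forall e, bar e <> e;
  org_bar : forall e, org (bar e) = tgt e
}.

Definition gpoint (T : sgraph) : Type := (vertex T + edge T)%type.

Lemma tgt_bar (T : sgraph) (e : edge T) : tgt (bar e) = org e.
Proof. by rewrite -org_bar barK. Qed.

(* A path is encoded by its origin v and its list of edges p; the trivial path
   at v is (v, [::]). *)
Fixpoint is_path (T : sgraph) (v : vertex T) (p : seq (edge T)) : Prop :=
  if p is e :: p' then org e = v /\ is_path (tgt e) p' else True.

Definition path_end (T : sgraph) (v : vertex T) (p : seq (edge T)) : vertex T :=
  last v (map (@tgt T) p).

Fixpoint reduced (T : sgraph) (p : seq (edge T)) : Prop :=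
  match p with
  | e :: ((f :: _) as p') => f <> bar e /\ reduced p'
  | _ => True
  end.

Definition geodesic (T : sgraph) (v : vertex T) (p : seq (edge T)) : Prop :=
  is_path v p /\ reduced p.

(* Length 1 gives loops and length 2 gives double edges. *)
Definition circuit (T : sgraph) (v : vertex T) (p : seq (edge T)) : Prop :=
  [/\ p <> [::], is_path v p, path_end v p = v, reduced p
    & List.NoDup (map (@org T) p)].

Definition connected_graph (T : sgraph) : Prop :=
  forall v w : vertex T, exists2 p, is_path v p & path_end v p = w.

Definition is_tree (T : sgraph) : Prop :=
  [/\ [set: vertex T] !=set0, connected_graph T
    & forall (v : vertex T) p, ~ circuit v p].

Definition locally_finite (T : sgraph) : Prop :=
  forall v : vertex T, finite_set [set e | org e = v].

Definition finite_graph (T : sgraph) : Prop :=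
  finite_set [set: vertex T] /\ finite_set [set: edge T].

Definition walk_length (T : sgraph) (v w : vertex T) : set nat :=
  [set n | exists p, [/\ is_path v p, path_end v p = w & size p = n]].

(* Only meaningful if v and w are joined by a path; the value is 0 otherwise. *)
Definition dist (T : sgraph) (v w : vertex T) : nat :=
  xget 0%N [set n | walk_length v w n /\
                    forall m, walk_length v w m -> (n <= m)%N].

Definition is_ray (T : sgraph) (r : nat -> edge T) : Prop :=
  (forall i, tgt (r i) = org (r i.+1)) /\ injective (fun i => org (r i)).

Definition ray_equiv (T : sgraph) (r s : nat -> edge T) : Prop :=
  exists m n, forall k, r (m + k)%N = s (n + k)%N.

Definition is_end (T : sgraph) (xi : set (nat -> edge T)) : Prop :=
  exists2 r, is_ray r & xi = [set s | is_ray s /\ ray_equiv r s].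

Record gaut (T : sgraph) := GAut {
  autV : vertex T -> vertex T;
  autE : edge T -> edge T;
  autV_bij : bijective autV;
  autE_bij : bijective autE;
  aut_org : forall e, org (autE e) = autV (org e);
  aut_bar : forall e, autE (bar e) = bar (autE e)
}.

Definition autP (T : sgraph) (f : gaut T) (t : gpoint T) : gpoint T :=
  match t with inl v => inl (autV f v) | inr e => inr (autE f e) end.

Lemma aut_tgt (T : sgraph) (f : gaut T) (e : edge T) :
  tgt (autE f e) = autV f (tgt e).
Proof. by rewrite -!org_bar -aut_bar aut_org. Qed.

Lemma gaut_eq (T : sgraph) (f g : gaut T) :
  autV f =1 autV g -> autE f =1 autE g -> f = g.
Proof.
case: f g => [a b ? ? ? ?] [c d ? ? ? ?] /= /funext eV /funext eE.
by subst c d; congr GAut; exact: Prop_irrelevance.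
Qed.

Section AutGroup.
Context (T : sgraph).

HB.instance Definition _ := gen_eqMixin (gaut T).
HB.instance Definition _ := gen_choiceMixin (gaut T).

Definition gaut_one : gaut T :=
  @GAut T id id (Bijective (fun=> erefl) (fun=> erefl))
    (Bijective (fun=> erefl) (fun=> erefl)) (fun=> erefl) (fun=> erefl).

(* (f * g) x = f (g x), so that homomorphisms to gaut T are left actions. *)
Definition gaut_mul (f g : gaut T) : gaut T.
Proof.
refine (@GAut T (autV f \o autV g) (autE f \o autE g)
  (bij_comp (autV_bij f) (autV_bij g))
  (bij_comp (autE_bij f) (autE_bij g)) _ _) => e /=.
- by rewrite !aut_org.
- by rewrite !aut_bar.
Defined.

Lemma gaut_inv_subproof (f : gaut T) :
  exists h : gaut T, gaut_mul h f = gaut_one /\ gaut_mul f h = gaut_one.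
Proof.
have [iV Vk kV] := autV_bij f; have [iE Ek kE] := autE_bij f.
have bV : bijective iV by exists (autV f).
have bE : bijective iE by exists (autE f).
have ho e : org (iE e) = iV (org e).
  by apply: (can_inj Vk); rewrite kV -aut_org kE.
have hb e : iE (bar e) = bar (iE e).
  by apply: (can_inj Ek); rewrite aut_bar !kE.
by exists (GAut bV bE ho hb); split; apply: gaut_eq => x /=.
Qed.

Definition gaut_inv (f : gaut T) : gaut T := projT1 (cid (gaut_inv_subproof f)).

Lemma gaut_mulA : associative gaut_mul.
Proof. by move=> f g h; apply: gaut_eq. Qed.

Lemma gaut_mul1 : left_id gaut_one gaut_mul.
Proof. by move=> f; apply: gaut_eq. Qed.

Lemma gaut_mulr1 : right_id gaut_one gaut_mul.
Proof. by move=> f; apply: gaut_eq. Qed.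

Lemma gaut_mulV : left_inverse gaut_one gaut_inv gaut_mul.
Proof. by move=> f; rewrite /gaut_inv; case: cid => h []. Qed.

Lemma gaut_mulrV : right_inverse gaut_one gaut_inv gaut_mul.
Proof. by move=> f; rewrite /gaut_inv; case: cid => h []. Qed.

HB.instance Definition _ := isGroup.Build (gaut T)
  gaut_mulA gaut_mul1 gaut_mulr1 gaut_mulV gaut_mulrV.

(* The permutation topology: the neighbourhoods of f are generated by the cosets
   f * Aut(T)_F, for F a finite set of vertices and edges. *)
Definition gaut_agree (f : gaut T) (F : set (gpoint T)) : set (gaut T) :=
  [set h | forall t, F t -> autP h t = autP f t].

Definition gaut_nbhs (f : gaut T) : set_system (gaut T) :=
  filter_from [set F | finite_set F] (gaut_agree f).

HB.instance Definition _ := hasNbhs.Build (gaut T) gaut_nbhs.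

Lemma gaut_nbhs_filter (f : gaut T) : ProperFilter (nbhs f).
Proof.
apply: filter_from_proper; last by move=> F _; exists f.
apply: filter_from_filter; first by exists set0; exact: finite_set0.
move=> F F' fF fF'; exists (F `|` F'); first by rewrite /= finite_setU.
by move=> h hh; split=> t Ft; apply: hh; [left|right].
Qed.

Lemma gaut_nbhs_singleton (f : gaut T) (A : set (gaut T)) : nbhs f A -> A f.
Proof. by case=> F _; apply. Qed.

Lemma gaut_nbhs_nbhs (f : gaut T) (A : set (gaut T)) :
  nbhs f A -> nbhs f (nbhs^~ A).
Proof.
case=> F fF FA; exists F => // h hh; exists F => // k kh.
by apply: FA => t Ft; rewrite kh // hh.
Qed.

HB.instance Definition _ := Nbhs_isNbhsTopological.Build (gaut T)
  gaut_nbhs_filter gaut_nbhs_singleton gaut_nbhs_nbhs.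

End AutGroup.

Section Action.
Context (G : groupType) (T : sgraph) (rho : {multiplicative G -> gaut T}).

Lemma act1 : rho 1%g = 1%g.
Proof. by apply: (@mulgI _ (rho 1%g)); rewrite -gmulfM !mulg1. Qed.

Definition stab (t : gpoint T) : set G := [set g | autP (rho g) t = t].
Definition stabV (v : vertex T) : set G := stab (inl v).
Definition stabE (e : edge T) : set G := stab (inr e).

Definition stab_end (xi : set (nat -> edge T)) : set G :=
  [set g | [set autE (rho g) \o r | r in xi] = xi].

Definition without_inversions : Prop :=
  forall g e, autE (rho g) e <> bar e.

Definition adjacent_stabs_incomparable : Prop :=
  forall e : edge T, ~ (stabV (org e) `<=` stabV (tgt e)) /\
                     ~ (stabV (tgt e) `<=` stabV (org e)).

Definition orbV (v : vertex T) : set (vertex T) :=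
  range (fun g => autV (rho g) v).
Definition orbE (e : edge T) : set (edge T) :=
  range (fun g => autE (rho g) e).

Definition qvertex : Type := set_type (range orbV).
Definition qedge : Type := set_type (range orbE).

Definition piV (v : vertex T) : qvertex := SigSub (mem_set (imageT orbV v)).
Definition piE (e : edge T) : qedge := SigSub (mem_set (imageT orbE e)).

Lemma org_orbE e : @org T @` orbE e = orbV (org e).
Proof.
by rewrite /orbE image_comp; congr image; apply: funext => g /=; rewrite aut_org.
Qed.

Lemma tgt_orbE e : @tgt T @` orbE e = orbV (tgt e).
Proof.
by rewrite /orbE image_comp; congr image; apply: funext => g /=; rewrite aut_tgt.
Qed.

Lemma bar_orbE e : @bar T @` orbE e = orbE (bar e).
Proof.
by rewrite /orbE image_comp; congr image; apply: funext => g /=; rewrite aut_bar.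
Qed.

Lemma qorg_subproof (x : qedge) : @org T @` val x \in range orbV.
Proof.
case: x => x /= /set_mem[e _ <-].
by rewrite org_orbE; apply/mem_set; exists (org e).
Qed.

Lemma qtgt_subproof (x : qedge) : @tgt T @` val x \in range orbV.
Proof.
case: x => x /= /set_mem[e _ <-].
by rewrite tgt_orbE; apply/mem_set; exists (tgt e).
Qed.

Lemma qbar_subproof (x : qedge) : @bar T @` val x \in range orbE.
Proof.
case: x => x /= /set_mem[e _ <-].
by rewrite bar_orbE; apply/mem_set; exists (bar e).
Qed.

Definition qorg (x : qedge) : qvertex := SigSub (qorg_subproof x).
Definition qtgt (x : qedge) : qvertex := SigSub (qtgt_subproof x).
Definition qbar (x : qedge) : qedge := SigSub (qbar_subproof x).

Lemma qbarK : involutive qbar.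
Proof.
move=> x; apply: val_inj => /=; rewrite image_comp.
by rewrite (_ : _ \o _ = id) ?image_id //; apply: funext => e /=; rewrite barK.
Qed.

Lemma qbar_neq : without_inversions -> forall x, qbar x <> x.
Proof.
move=> noinv [x xE] /(congr1 val) /=; move/set_mem: (xE) => [e _ <-].
rewrite bar_orbE => be; have : orbE (bar e) (bar e).
  by exists 1%g => //; rewrite act1.
by rewrite be => -[g _]; exact: noinv.
Qed.

Lemma qorg_bar x : qorg (qbar x) = qtgt x.
Proof.
apply: val_inj => /=; rewrite image_comp.
by congr image; apply: funext => e /=; rewrite org_bar.
Qed.

Definition quotient_graph (noinv : without_inversions) : sgraph :=
  SGraph qbarK (qbar_neq noinv) qorg_bar.

Definition weakly_locally_infty_transitive (noinv : without_inversions) : Prop :=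
  forall (v : vertex T) (P : seq (edge (quotient_graph noinv))),
    is_path (piV v : vertex (quotient_graph noinv)) P ->
    forall p q : seq (edge T),
      geodesic v p -> map piE p = P -> geodesic v q -> map piE q = P ->
      exists2 g, stabV v g & map (autE (rho g)) p = q.

(* L is the set of vertices of a geodesic or of a ray.  Since these vertices are
   pairwise distinct, the elements of L themselves serve as the indices n. *)
Definition is_line (L : set (vertex T)) : Prop :=
  (exists v p, geodesic v p /\ L = [set w | List.In w (v :: map (@tgt T) p)]) \/
  (exists2 r, is_ray r & L = range (fun i => org (r i))).

(* For w in L: the fibre over w of the closest point projection to L. *)
Definition proj_fibre (L : set (vertex T)) (w : vertex T) : set (vertex T) :=
  [set v | forall u, L u -> (dist v w <= dist v u)%N].

(* In a tree, fixing the vertices of L also fixes the edges between them. *)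
Definition line_fixator (L : set (vertex T)) : set G :=
  [set g | forall w, L w -> autV (rho g) w = w].

Definition fibre_perms (L : set (vertex T)) (w : vertex T) :
    set (proj_fibre L w -> proj_fibre L w) :=
  [set s | exists2 g, line_fixator L g &
           forall x, val (s x) = autV (rho g) (val x)].

Definition property_P : Prop :=
  forall L : set (vertex T), is_line L ->
  forall s : (forall w : L, proj_fibre L (val w) -> proj_fibre L (val w)),
    (forall w : L, fibre_perms (s w)) ->
    exists2 g, line_fixator L g &
      forall (w : L) x, val (s w x) = autV (rho g) (val x).

(* Closedness refers to the permutation topology of gaut T; G is identified with
   its image, but need not carry the subspace topology. *)
Definition P_closed : Prop :=
  [/\ injective rho, closed (range rho) & property_P].

End Action.

Section DoubleCosets.
Context (G : groupType).
Implicit Types (H K D : set G) (g : G).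

Definition double_coset H g K : set G := [set (h * g * k)%g | h in H & k in K].

Definition left_cosets D K : set (set G) :=
  [set [set (x * k)%g | k in K] | x in D].

Definition dcosets_of_size H K (n : nat) : set (set G) :=
  [set D | (exists g, D = double_coset H g K) /\ (left_cosets D K #= `I_n)%card].

(* The number a_n(G, H, K); only meaningful if dcosets_of_size H K n is finite. *)
Definition dcoset_count H K (n : nat) : nat :=
  #|` fset_set (dcosets_of_size H K n) |.

Definition finite_dcosets H K : Prop :=
  forall g, finite_set (left_cosets (double_coset H g K) K).

Definition double_coset_property H K : Prop :=
  finite_dcosets H K /\
  forall n, (1 <= n)%N -> finite_set (dcosets_of_size H K n).

(* The bound a_n = O(n^alpha) presupposes that all the a_n, n >= 1, are finite. *)
Definition polynomial_double_coset_growth (R : realType) H K : Prop :=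
  double_coset_property H K /\
  exists2 alpha : R, (0 <= alpha)%R &
    (fun n => (dcoset_count H K n)%:R%R : R^o) =O_\oo
    (fun n => (n%:R%R `^ alpha)%R : R^o).

End DoubleCosets.

(* Main.v *)
Require Import Defs.
From mathcomp Require Import all_boot all_order all_algebra.
From mathcomp Require Import all_classical all_reals all_analysis.
From mathcomp Require Import finmap zify.
From Stdlib Require List.
Import Order.TTheory GRing.Theory Num.Theory.
Import numFieldNormedType.Exports.

(* The double coset G_{t1} g G_{t2} has as many left cosets as the G_{t1}-orbit
   of g t2 has points, so everything is about orbit sizes.

   If G_e stabilises an end, it fixes the tail of a ray towards that end.  By
   cofiniteness infinitely many edges of the tail are translates x_k f of one
   edge f, and the G_{t1}-orbit of x_k t2 is an image of (G_{t1} e) x (G_f t2),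
   whose size does not depend on k: some a_n is infinite.

   Conversely, if no G_e stabilises an end, König's lemma and cofiniteness give
   N such that G_e moves every geodesic of length N that continues e.  Each of
   the two hypotheses on the action lets a move by G_e of a continuation of e be
   realised while fixing any geodesic arriving through e.  Hence the orbit of a
   vertex at distance > m N has at least 2^m points, whereas a ball of radius r
   has at most C^r points, and a_n grows polynomially. *)

Set Implicit Arguments.
Unset Strict Implicit.
Unset Printing Implicit Defensive.

Local Open Scope classical_set_scope.

(** * Paths, their reversal and their reduction *)

Section Paths.
Context (T : sgraph).
Implicit Types (v w : vertex T) (e f : edge T) (p q : seq (edge T)).

Lemma path_end_cat v p q : path_end v (p ++ q) = path_end (path_end v p) q.
Proof. by rewrite /path_end map_cat last_cat. Qed.

Lemma path_end_rcons v p e : path_end v (rcons p e) = tgt e.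
Proof. by rewrite /path_end map_rcons last_rcons. Qed.

Lemma is_path_cat v p q :
  is_path v (p ++ q) <-> is_path v p /\ is_path (path_end v p) q.
Proof.
elim: p v => [|e p IH] v /=; first by split=> [|[]].
by rewrite IH /path_end /=; tauto.
Qed.

Lemma reduced_cat_cons p e q :
  reduced (p ++ e :: q) <-> reduced (rcons p e) /\ reduced (e :: q).
Proof.
elim: p => [|f p IH]; first by rewrite /=; tauto.
case: p IH => [|g p] /= IH; first by tauto.
by rewrite IH; tauto.
Qed.

Lemma reduced_cat p q : reduced (p ++ q) -> reduced p /\ reduced q.
Proof.
elim: p => [|e [|f p] IH] //=; first by case: q {IH} => [|f q] //= [].
by case=> ne /IH[].
Qed.

Lemma reduced_rcons2 p e f :
  reduced (rcons (rcons p e) f) <-> reduced (rcons p e) /\ f <> bar e.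
Proof.
by rewrite -[rcons (rcons p e) f]cats1 cat_rcons reduced_cat_cons /=; tauto.
Qed.

Definition rev_path p := rev (map (@bar T) p).

Lemma rev_path_cons e p : rev_path (e :: p) = rcons (rev_path p) (bar e).
Proof. by rewrite /rev_path /= rev_cons. Qed.

Lemma rev_path_end v p : is_path v p -> path_end (path_end v p) (rev_path p) = v.
Proof.
case: p => [//|e p] /= [<- _].
by rewrite rev_path_cons path_end_rcons tgt_bar.
Qed.

Lemma is_path_rev v p : is_path v p -> is_path (path_end v p) (rev_path p).
Proof.
elim: p v => [//|e p IH] v /= [<- pp].
rewrite rev_path_cons -cats1 is_path_cat; split; first exact: IH.
by rewrite [path_end _ (e :: p)]/(path_end (tgt e) p) rev_path_end //= org_bar.
Qed.

Lemma reduced_rev p : reduced p -> reduced (rev_path p).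
Proof.
elim: p => [//|e [//|f p] IH] /= [ne rp].
rewrite !rev_path_cons reduced_rcons2 -rev_path_cons; split; first exact: IH.
by rewrite barK => ef; apply: ne; rewrite ef.
Qed.

Lemma walk_length_sym v w : walk_length v w = walk_length w v.
Proof.
have sub v' w' : walk_length v' w' `<=` walk_length w' v'.
  move=> n [p [pp <- <-]]; exists (rev_path p); split.
  - exact: is_path_rev.
  - exact: rev_path_end.
  - by rewrite size_rev size_map.
by apply/seteqP; split; apply: sub.
Qed.

Lemma dist_sym v w : dist v w = dist w v.
Proof. by rewrite /dist walk_length_sym. Qed.

(** Reduction from the tail: prepending an edge to a reduced path creates a backtrack only at the
    front, and cancelling it leaves a tail of a reduced path. *)
Lemma walk_reduced v p : is_path v p ->
  exists q, [/\ geodesic v q, path_end v q = path_end v p & (size q <= size p)%N].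
Proof.
elim: p v => [|e p IH] v /=; first by exists [::].
case=> <- /IH[[|f q] [[pq rq] eq sq]].
  by exists [:: e]; split=> //; rewrite /geodesic.
have [fe|fe] := pselect (f = bar e); last first.
  by exists [:: e, f & q]; split=> //; split.
exists q; split=> /=; last by rewrite (leq_trans _ (leqW sq)).
  split; last by case: (q) rq => [//|g q'] [].
  by case: pq => _; rewrite fe tgt_bar.
by rewrite -[RHS]eq /path_end /= fe tgt_bar.
Qed.

(** * Geodesics and distances in trees *)

Section Tree.
Hypothesis T_tree : is_tree T.

Lemma NoDupPn (A : Type) (s : seq A) : ~ List.NoDup s ->
  exists s1 x s2 s3, s = s1 ++ x :: s2 ++ x :: s3.
Proof.
elim: s => [|x s IH] ns; first by case: ns; constructor.
have [xs|xs] := pselect (List.In x s).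
  have [s2 [s3 ->]] := List.in_split x s xs.
  by exists [::], x, s2, s3.
have [|s1 [y [s2 [s3 ->]]]] := IH; last by exists (x :: s1), y, s2, s3.
by move=> nds; apply: ns; constructor.
Qed.

Lemma split_map (A B : Type) (h : A -> B) s s1 x s2 : map h s = s1 ++ x :: s2 ->
  exists t1 a t2, [/\ s = t1 ++ a :: t2, map h t1 = s1, h a = x & map h t2 = s2].
Proof.
elim: s s1 => [|a s IH] [|y s1] //= [].
  by move=> ? ?; exists [::], a, s.
by move=> ha /IH[t1 [b [t2 [-> <- <- <-]]]]; exists (a :: t1), b, t2; rewrite -ha.
Qed.

(* A shortest reduced closed path has distinct origins, so it is a circuit. *)
Lemma reduced_closed_nil v p : geodesic v p -> path_end v p = v -> p = [::].
Proof.
have [n] := ubnP (size p); elim: n v p => // n IH v p szp [pp rp] ep.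
apply: contrapT => p0; case: T_tree => _ _ /(_ v p); apply; split=> //.
apply: contrapT => /NoDupPn[s1 [x [s2 [s3 sE]]]].
have [t1 [a [t2 [pE _ ax t2s]]]] := split_map sE.
have [t3 [b [t4 [t2E _ bx _]]]] := split_map t2s.
subst t2; move: pp rp; rewrite pE => /is_path_cat[_ pp] /reduced_cat[_ rp].
suff: a :: t3 = [::] by [].
move: pp rp; rewrite -cat_cons => /is_path_cat[pa pb] /reduced_cat[ra _].
apply: (IH x).
- by move: szp; rewrite pE !size_cat /= size_cat /=; lia.
- by split=> //; case: pa => _; rewrite /= ax.
- by rewrite -[RHS]bx; case: pb.
Qed.

(** After cancelling equal first edges, the reversal of one path followed by the other would be a
    nonempty reduced closed path. *)
Lemma geodesic_inj v p q :
  geodesic v p -> geodesic v q -> path_end v p = path_end v q -> p = q.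
Proof.
elim: p v q => [|e p IH] v q.
  by move=> _ gq eq; apply/esym/(reduced_closed_nil gq).
case: q => [|f q]; first by move=> gp _ ep; exact: (reduced_closed_nil gp).
have [<- [[ov pp] rp] [[_ pq] rq] ee|ef gp gq ee] := pselect (e = f).
  congr (_ :: _); apply: (IH (tgt e)) => //; split=> //.
    by case: (p) rp => [//|g p'] [].
  by case: (q) rq => [//|g p'] [].
have [[[oe pp] rp] [[of_ pq] rq]] := (gp, gq).
suff : rev_path (e :: p) ++ f :: q = [::] by case: (rev_path _).
apply: (@reduced_closed_nil (path_end v (e :: p))).
  split.
    apply/is_path_cat; split; first exact: is_path_rev.
    by rewrite rev_path_end.
  apply/reduced_cat_cons; split => //.
  rewrite rev_path_cons reduced_rcons2 -rev_path_cons; split.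
    exact: reduced_rev.
  by rewrite barK => /esym.
by rewrite path_end_cat rev_path_end.
Qed.

Lemma geodesicP v w : exists2 p, geodesic v p & path_end v p = w.
Proof.
have [_ /(_ v w)[p pp <-] _] := T_tree.
by have [q [gq eq _]] := walk_reduced pp; exists q.
Qed.

(** Every walk reduces, without getting longer, to a geodesic with the same ends, and that geodesic
    is unique. *)
Lemma dist_geodesic v p : geodesic v p -> dist v (path_end v p) = size p.
Proof.
move=> gp; rewrite /dist.
have pmin m : walk_length v (path_end v p) m -> (size p <= m)%N.
  case=> q [pq eq <-]; have [q' [gq' eq' sq']] := walk_reduced pq.
  by rewrite (geodesic_inj gp gq') // eq' eq.
have pw : walk_length v (path_end v p) (size p).
  by exists p; split=> //; case: gp.
case: xgetP => [m _ [mw mmin]|/(_ (size p))]; last by case; split.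
by apply/eqP; rewrite eqn_leq mmin // pmin.
Qed.

End Tree.
End Paths.

(** * Cardinality bounds for finite sets *)

Section Cardinality.

Lemma card_le_onto (A B : Type) (f : A -> B) (X : set A) (Y : set B) :
  (forall y, Y y -> exists2 x, X x & f x = y) -> (Y #<= X)%card.
Proof.
move=> fXY; apply: card_le_trans (card_image_le f X).
by apply: subset_card_le => y /fXY[x Xx <-]; exists x.
Qed.

Lemma card_le_inj (A B : Type) (f : A -> B) (X : set A) (Y : set B) :
  (forall x, X x -> Y (f x)) ->
  (forall x x', X x -> X x' -> f x = f x' -> x = x') -> (X #<= Y)%card.
Proof.
move=> fXY finj; have fK : {in X &, injective f}.
  by move=> x x' /set_mem Xx /set_mem Xx'; exact: finj.
rewrite -(card_le_eql (inj_card_eq fK)); apply: subset_card_le.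
by move=> _ [x Xx <-]; exact: fXY.
Qed.

Lemma card_le_enum (A : Type) (a : A) (X : set A) n : (X #<= `I_n)%card ->
  exists f : nat -> A, forall x, X x -> exists2 j, (j < n)%N & f j = x.
Proof.
case/pfcard_geP => [->|[f]]; first by exists (fun=> a).
by exists f => x /(@surj _ _ _ _ f)[j jn <-]; exists j.
Qed.

(** Counts objects built in two stages: quotient and remainder modulo [k] of an index below [m * k]
    encode the two choices. *)
Lemma card_le_mul (A B : Type) (X : set A) (Y : set B) (step : A -> nat -> B)
    m k (a : A) : (X #<= `I_m)%card ->
  (forall y, Y y -> exists x j, [/\ X x, (j < k)%N & step x j = y]) ->
  (Y #<= `I_(m * k))%card.
Proof.
move=> /(card_le_enum a)[dec decP] stepP.
apply: (@card_le_onto _ _ (fun i => step (dec (i %/ k)%N) (i %% k)%N)) => y.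
move=> /stepP[x [j [/decP[i im <-] jk <-]]].
exists (i * k + j)%N => /=; first by nia.
by rewrite divnMDl ?(leq_trans _ jk)// divn_small // addn0 modnMDl modn_small.
Qed.

Lemma card_le_setX (A B : Type) (X : set A) (Y : set B) m n :
  (X #<= `I_m)%card -> (Y #<= `I_n)%card -> (X `*` Y #<= `I_(m * n))%card.
Proof.
have [[b Yb]|noY] := pselect (exists b, Y b); last first.
  move=> _ _; rewrite (_ : X `*` Y = set0) ?card_ge0 //.
  by apply/seteqP; split=> // -[a b] [_ Yb]; apply: noY; exists b.
have [[a Xa]|noX] := pselect (exists a, X a); last first.
  move=> _ _; rewrite (_ : X `*` Y = set0) ?card_ge0 //.
  by apply/seteqP; split=> // -[a b'] [Xa _]; apply: noX; exists a.
move=> Xm /(card_le_enum b)[dec decP].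
apply: (card_le_mul (step := fun a j => (a, dec j)) a Xm) => -[a' b'] [Xa' Yb'].
by have [j jn <-] := decP b' Yb'; exists a', j.
Qed.

(** Serves for bounds over the finitely many orbits and, in König's lemma, over the finitely many
    edges at a vertex. *)
Lemma finite_uniform_bound (A : Type) (D : set A) (P : A -> nat -> Prop) :
  finite_set D -> (forall a n m, (n <= m)%N -> P a n -> P a m) ->
  (forall a, D a -> exists n, P a n) -> exists N, forall a, D a -> P a N.
Proof.
move=> fD Pmono exP.
have /choice[f fP] a : exists n, D a -> P a n.
  have [/exP[n]|nDa] := pselect (D a); first by exists n.
  by exists 0%N.
have /finite_fsetP[X fX] : finite_set (f @` D) by exact: finite_image.
exists (\max_(x <- X) x)%N => a Da; apply: Pmono (fP a Da).
have /= : [set` X] (f a) by rewrite -fX; exists a.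
by move=> aX; exact: (@leq_bigmax_seq _ _ xpredT id).
Qed.

End Cardinality.

(** * Automorphisms and the size of balls *)

Section Automorphisms.
Context (T : sgraph).
Implicit Types (f : gaut T) (v w : vertex T) (p q : seq (edge T)).

Lemma path_end_aut f v p :
  path_end (autV f v) (map (autE f) p) = autV f (path_end v p).
Proof.
by elim: p v => [//|e p IH] v; rewrite {1}/path_end /= aut_tgt; exact: IH.
Qed.

Lemma is_path_aut f v p : is_path v p -> is_path (autV f v) (map (autE f) p).
Proof.
elim: p v => [//|e p IH] v /= [<- pp]; split; first by rewrite aut_org.
by rewrite aut_tgt; exact: IH.
Qed.

Lemma reduced_aut f p : reduced p -> reduced (map (autE f) p).
Proof.
elim: p => [//|e [//|e' p] IH] [ne rp]; split; last exact: IH.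
by rewrite -aut_bar => /(bij_inj (autE_bij f)).
Qed.

Lemma geodesic_aut f v p : geodesic v p -> geodesic (autV f v) (map (autE f) p).
Proof. by case=> pp rp; split; [exact: is_path_aut|exact: reduced_aut]. Qed.

(** Whatever fixes a point fixes its base, so vertices and edges can be treated together. *)
Definition base (t : gpoint T) : vertex T :=
  match t with inl v => v | inr e => org e end.

Lemma base_aut f t : base (autP f t) = autV f (base t).
Proof. by case: t => [//|e] /=; rewrite aut_org. Qed.

Definition graph_ball v n : set (vertex T) :=
  [set w | exists p, [/\ is_path v p, path_end v p = w & (size p <= n)%N]].

Lemma ball_aut f v n w : graph_ball v n w -> graph_ball (autV f v) n (autV f w).
Proof.
case=> p [pp <- sp]; exists (map (autE f) p); split.
- exact: is_path_aut.
- exact: path_end_aut.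
- by rewrite size_map.
Qed.

Section BallCard.
Context (C : nat) (e0 : edge T).
Hypothesis cardC : forall v, ([set e | org e = v] #<= `I_C)%card.

Lemma card_ball v n : (graph_ball v n #<= `I_(C.+1 ^ n))%card.
Proof.
have /choice[num numP] u := card_le_enum e0 (cardC u).
elim: n => [|n IH].
  apply: (@card_le_onto _ _ (fun=> v)) => w [[|e p] [_ <-]] // _.
  by exists 0%N.
(* Index 0 stays at [u], which covers the trivial walk; hence the factor [C.+1] instead of [C]. *)
rewrite expnSr; pose step u j := if j is j'.+1 then tgt (num u j') else u.
apply: (card_le_mul (step := step) v IH) => w [p [pp <- sp]].
case/lastP: p pp sp => [_ _|p e].
  by exists v, 0%N; split=> //; exists [::].
rewrite -cats1 => /is_path_cat[pp [oe _]]; rewrite size_cat addn1 ltnS => sp.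
have [j jC je] := numP (path_end v p) e oe.
exists (path_end v p), j.+1; split=> //=; first by exists p.
by rewrite je cats1 path_end_rcons.
Qed.

Lemma card_points v n :
  ([set t | graph_ball v n (base t)] #<= `I_(C.+1 ^ n.+1))%card.
Proof.
have /choice[num numP] u := card_le_enum e0 (cardC u).
rewrite expnSr.
pose step u j : gpoint T := if j is j'.+1 then inr (num u j') else inl u.
apply: (card_le_mul (step := step) v (card_ball v n)) => -[u|e] bt.
  by exists u, 0%N.
by have [j jC je] := numP (org e) e erefl; exists (org e), j.+1; rewrite /= je.
Qed.

End BallCard.
End Automorphisms.

(** * Orbits, double cosets and the quotient graph *)

Section Action.
Context (G : groupType) (T : sgraph) (rho : {multiplicative G -> gaut T}).
Implicit Types (g h x : G) (s t : gpoint T) (v w : vertex T) (e f : edge T).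

Lemma actP g h t : autP (rho (g * h)%g) t = autP (rho g) (autP (rho h) t).
Proof. by rewrite gmulfM; case: t. Qed.

Lemma actE g h e : autE (rho (g * h)%g) e = autE (rho g) (autE (rho h) e).
Proof. by rewrite gmulfM. Qed.

Lemma act1P t : autP (rho 1%g) t = t.
Proof. by rewrite act1; case: t. Qed.

Lemma actPK g t : autP (rho g^-1%g) (autP (rho g) t) = t.
Proof. by rewrite -actP mulVg act1P. Qed.

Lemma actEK g e : autE (rho g^-1%g) (autE (rho g) e) = e.
Proof. by have [] := actPK g (inr e). Qed.

Lemma actPVK g t : autP (rho g) (autP (rho g^-1%g) t) = t.
Proof. by rewrite -actP mulgV act1P. Qed.

Lemma actEVK g e : autE (rho g) (autE (rho g^-1%g) e) = e.
Proof. by have [] := actPVK g (inr e). Qed.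

Lemma stabM t g h : stab rho t g -> stab rho t h -> stab rho t (g * h)%g.
Proof. by rewrite /stab /= actP => gt ->. Qed.

Lemma stabVg t g : stab rho t g -> stab rho t g^-1%g.
Proof. by rewrite /stab /= => {1}<-; rewrite actPK. Qed.

Lemma stab1 t : stab rho t 1%g.
Proof. exact: act1P. Qed.

Lemma stabEP e g : stabE rho e g <-> autE (rho g) e = e.
Proof. by split=> [[]|] //; rewrite /stabE /stab /= => ->. Qed.

Lemma stabVP v g : stabV rho v g <-> autV (rho g) v = v.
Proof. by split=> [[]|] //; rewrite /stabV /stab /= => ->. Qed.

Lemma stab_base t : stab rho t `<=` stabV rho (base t).
Proof. by move=> g gt; apply/stabVP; rewrite -base_aut gt. Qed.

Definition orb (H : set G) t : set (gpoint T) := [set autP (rho g) t | g in H].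

(** Orbit-stabiliser correspondence: the left coset of [z] modulo the stabiliser of [t] is the set
    of all elements taking [t] to the same point as [z]. *)
Lemma left_cosets_orb s t x :
  (left_cosets (double_coset (stab rho s) x (stab rho t)) (stab rho t) #=
   orb (stab rho s) (autP (rho x) t))%card.
Proof.
pose pt y := [set z | autP (rho z) t = y].
have ptE z : [set (z * k)%g | k in stab rho t] = pt (autP (rho z) t).
  apply/seteqP; split=> [_ [k kt <-]|y yz]; first by rewrite /pt /= actP kt.
  by exists (z^-1 * y)%g; [rewrite /stab /= actP yz actPK|rewrite mulVKg].
rewrite (_ : left_cosets _ _ = pt @` orb (stab rho s) (autP (rho x) t)).
  apply: inj_card_eq => y y' /set_mem[g _ <-] _ ptyy.
  suff : pt y' (g * x)%g by rewrite /pt /= actP.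
  by rewrite -ptyy /pt /= actP.
apply/seteqP; split=> [_ [_ [h hs [k kt <-]] <-]|_ [_ [g gs <-] <-]].
  by exists (autP (rho (h * x)%g) t); [exists h; rewrite ?actP|rewrite ptE !actP kt].
exists (g * x * 1)%g; last by rewrite ptE !actP act1P.
by exists g => //; exists 1%g => //; exact: stab1.
Qed.

(** A double coset can thus be recovered from any single point of its orbit, which is how double
    cosets are counted later. *)
Lemma double_cosetE s t x :
  double_coset (stab rho s) x (stab rho t) =
  [set z | orb (stab rho s) (autP (rho x) t) (autP (rho z) t)].
Proof.
apply/seteqP; split=> [_ [g gs [k kt <-]]|z [g gs gz]].
  by exists g => //; rewrite !actP kt.
exists g => //; exists (x^-1 * g^-1 * z)%g; last by rewrite !mulgA mulgK mulgV mul1g.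
by rewrite /stab /= !actP -gz !actPK.
Qed.

Lemma piV_eq v w : piV rho v = piV rho w -> exists g, autV (rho g) v = w.
Proof.
move=> /(congr1 val) /= vw; have : orbV rho w w by exists 1%g; rewrite ?act1.
by rewrite -vw => -[g _ gv]; exists g.
Qed.

Lemma piE_eq e f : Defs.piE rho e = Defs.piE rho f -> exists g, autE (rho g) e = f.
Proof.
move=> /(congr1 val) /= vw; have : orbE rho f f by exists 1%g; rewrite ?act1.
by rewrite -vw => -[g _ gv]; exists g.
Qed.

Lemma piE_act g e : Defs.piE rho (autE (rho g) e) = Defs.piE rho e.
Proof.
apply: val_inj; apply/seteqP; split=> _ [h _ <-] /=.
  by exists (h * g)%g; rewrite ?actE.
by exists (h * g^-1)%g; rewrite ?actE ?actEK.
Qed.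

Lemma piV_onto (x : qvertex rho) : exists v, piV rho v = x.
Proof.
by case: x => x xX; have /set_mem[v _ vx] := xX; exists v; apply: val_inj.
Qed.

Lemma piE_onto (x : qedge rho) : exists e, Defs.piE rho e = x.
Proof.
by case: x => x xX; have /set_mem[v _ vx] := xX; exists v; apply: val_inj.
Qed.

Section Cofinite.
Hypothesis T_tree : is_tree T.
Hypothesis T_lf : locally_finite T.
Hypothesis fin_qV : finite_set [set: qvertex rho].
Hypothesis T_edge : [set: edge T] !=set0.

(** Degrees are constant on vertex orbits, of which there are finitely many. *)
Lemma degree_bound : exists C, forall v, ([set e | org e = v] #<= `I_C)%card.
Proof.
pose P (x : qvertex rho) n :=
  forall v, piV rho v = x -> ([set e | org e = v] #<= `I_n)%card.
have [||N NP] := @finite_uniform_bound _ setT P fin_qV; last first.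
- by exists N => v; exact: (NP (piV rho v)).
- move=> x _; have [v vx] := piV_onto x.
  have /finite_set_leP[n nP] := T_lf v.
  exists n => w; rewrite -vx => /piV_eq[g gw]; apply: card_le_trans nP.
  apply: (@card_le_inj _ _ (autE (rho g))) => [e /= ew|e e' _ _].
    by rewrite aut_org ew.
  exact: (bij_inj (autE_bij (rho g))).
- move=> x n m nm xn v vx; apply: card_le_trans (xn v vx) _.
  by rewrite card_le_II.
Qed.

(** The stabiliser of [s] preserves every ball around [base s], and balls are finite. *)
Lemma orb_finite s t : finite_set (orb (stab rho s) t).
Proof.
have [C CP] := degree_bound; have [e0 _] := T_edge.
have [_ /(_ (base s) (base t))[p pp pe] _] := T_tree.
apply/finite_set_leP; exists (C.+1 ^ (size p).+1)%N.
apply: card_le_trans (card_points e0 CP (base s) (size p)).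
apply: subset_card_le => _ [g /stab_base/stabVP gs <-] /=.
by rewrite base_aut -gs; apply: ball_aut; exists p.
Qed.

End Cofinite.
End Action.

(** * Rays and the geodesics that run into them *)

Section Rays.
Context (T : sgraph).
Implicit Types (r : nat -> edge T) (v : vertex T).

Lemma ray_is_path r i k : is_ray r -> is_path (org (r i)) (map r (iota i k)).
Proof.
by move=> [rr _]; elim: k i => //= k IH i; split=> //; rewrite rr; exact: IH.
Qed.

Lemma ray_path_end r i k : is_ray r ->
  path_end (org (r i)) (map r (iota i k)) = org (r (i + k)%N).
Proof.
move=> [rr _]; elim: k i => [|k IH] i; first by rewrite addn0.
by rewrite addnS -addSn -IH /path_end /= rr.
Qed.

Lemma ray_step_reduced r i : is_ray r -> r i.+1 <> bar (r i).
Proof.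
move=> [rr rinj] ri; have := rr i.+1; rewrite ri tgt_bar.
by move/rinj/eqP; lia.
Qed.

Lemma ray_reduced r i k : is_ray r -> reduced (map r (iota i k)).
Proof.
move=> rr; elim: k i => [//|[//|k] IH] i; split; last exact: (IH i.+1).
exact: ray_step_reduced.
Qed.

Lemma ray_aut (f : gaut T) r : is_ray r -> is_ray (autE f \o r).
Proof.
move=> [rr rinj]; split=> [i|i j] /=; first by rewrite aut_tgt aut_org rr.
by rewrite !aut_org => /(bij_inj (autV_bij f))/rinj.
Qed.

Hypothesis T_tree : is_tree T.

(* [r i] is a closest point of the ray to [v]. *)
Lemma ray_eventually_geodesic v r : is_ray r -> exists i p,
  path_end v p = org (r i) /\ forall k, geodesic v (p ++ map r (iota i k)).
Proof.
move=> rr; pose P n := `[< exists i, dist v (org (r i)) = n >].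
have exP : exists n, P n by exists (dist v (org (r 0%N))); apply/asboolP; exists 0%N.
case: (ex_minnP exP) => n /asboolP[i <-] nmin.
have [p gp pe] := geodesicP T_tree v (org (r i)).
exists i, p; split=> // k; have [pp rp] := gp; split.
  by apply/is_path_cat; rewrite pe; split=> //; exact: ray_is_path.
case: k => [|k]; first by rewrite cats0.
apply/reduced_cat_cons; split; last exact: (@ray_reduced r i k.+1).
case/lastP: p pp rp gp pe => [//|p e] pp rp gp pe.
(* If [r i] backtracked along [e], the origin of [r i.+1] would be closer to [v]. *)
apply/reduced_rcons2; split=> // re; move: pp rp; rewrite -cats1.
move=> /is_path_cat[pp [oe _]] /reduced_cat[rp _].
have gp' : geodesic v p by [].
have /nmin : P (size p).
  apply/asboolP; exists i.+1.
  by rewrite -(dist_geodesic T_tree gp') -rr.1 re tgt_bar -oe.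
by rewrite -pe dist_geodesic // size_rcons ltnn.
Qed.

End Rays.

(** * Edge stabilisers contained in an end stabiliser *)

Section EndFixator.
Context (G : groupType) (T : sgraph) (rho : {multiplicative G -> gaut T}).
Hypothesis T_tree : is_tree T.

Lemma geodesic_fixed v p g : geodesic v p -> autV (rho g) v = v ->
  autV (rho g) (path_end v p) = path_end v p -> map (autE (rho g)) p = p.
Proof.
move=> gp gv ge; apply: (geodesic_inj T_tree (v := v)) => //.
  by rewrite -{1}gv; exact: geodesic_aut.
by rewrite -{1}gv path_end_aut.
Qed.

(* An element of [G_e] preserves the distance to [e], so it cannot translate
   along the ray. *)
Lemma end_fixator e xi : is_end xi -> stabE rho e `<=` stab_end rho xi ->
  exists r i0, is_ray r /\
    forall g i, stabE rho e g -> (i0 <= i)%N -> autE (rho g) (r i) = r i.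
Proof.
move=> [r rr xiE] sub.
have [i [p [pe gp]]] := ray_eventually_geodesic T_tree (org e) rr.
exists r, i; split=> // g i' ge ii'; rewrite -(subnKC ii').
move: (i' - i)%N => j {ii' i'}.
have gv : autV (rho g) (org e) = org e by rewrite -aut_org (stabEP _ _ _).1.
have peE k : path_end (org e) (p ++ map r (iota i k)) = org (r (i + k)%N).
  by rewrite path_end_cat pe ray_path_end.
have dE k : dist (org e) (org (r (i + k)%N)) = (size p + k)%N.
  by rewrite -peE dist_geodesic // size_cat size_map size_iota.
have : xi (autE (rho g) \o r).
  rewrite -(sub g ge); exists r => //; rewrite xiE; split=> //.
  by exists 0%N, 0%N.
rewrite xiE => -[_ [m [n mn]]].
have gdist k : autV (rho g) (path_end (org e) (p ++ map r (iota i k))) =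
    path_end (org e) (map (autE (rho g)) (p ++ map r (iota i k))).
  by rewrite -path_end_aut gv.
have dgE k : dist (org e) (autV (rho g) (org (r (i + k)%N))) = (size p + k)%N.
  rewrite -peE gdist dist_geodesic // ?size_map ?size_cat ?size_map ?size_iota //.
  by rewrite -{1}gv; exact: geodesic_aut.
have mnE : m = n.
  have := mn i => /(congr1 (@org T)) /= /(congr1 (dist (org e))).
  rewrite aut_org [(m + i)%N]addnC dE [(n + i)%N]addnC dgE; lia.
subst n.
(* Far enough out that the geodesic to the origin of [r (i + k)] passes through [r (i + j)] and that
   [mn] shows this origin to be fixed. *)
pose k := (m + j).+1.
have : map (autE (rho g)) (p ++ map r (iota i k)) = p ++ map r (iota i k).
  apply: geodesic_fixed gv _ => //.
  rewrite peE; have -> : (i + k = m + (i + j).+1)%N by rewrite /k; lia.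
  by rewrite -aut_org; congr org; exact/esym/mn.
move=> /(congr1 (fun s => nth (r 0%N) s (size p + j)%N)).
have jk : (j < k)%N by rewrite /k; lia.
move: k jk => k jk.
rewrite (nth_map (r 0%N)) ?size_cat ?size_map ?size_iota ?ltn_add2l //.
by rewrite nth_cat ltnNge leq_addr /= addKn (nth_map 0%N) ?size_iota // nth_iota.
Qed.

End EndFixator.

(** * The double-coset property excludes edge stabilisers inside end stabilisers *)

Section Necessity.
Context (G : groupType) (T : sgraph) (rho : {multiplicative G -> gaut T}).
Hypothesis T_tree : is_tree T.
Hypothesis T_lf : locally_finite T.
Hypothesis fin_qV : finite_set [set: qvertex rho].
Hypothesis fin_qE : finite_set [set: qedge rho].
Hypothesis T_edge : [set: edge T] !=set0.

Let orb_fin := orb_finite T_tree T_lf fin_qV T_edge.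

Lemma orb_double_coset s t x :
  [set autP (rho z) t | z in double_coset (stab rho s) x (stab rho t)] =
  orb rho (stab rho s) (autP (rho x) t).
Proof.
apply/seteqP; split=> [_ [z + <-]|y [g gs <-]].
  by rewrite double_cosetE.
by exists (g * x)%g; rewrite ?actP // double_cosetE /= actP; exists g.
Qed.

(** Such points lie in the orbits attached to finitely many double cosets, and each of these orbits
    is finite. *)
Lemma double_coset_property_small_orbits s t M :
  double_coset_property (stab rho s) (stab rho t) ->
  finite_set [set y | (exists x, autP (rho x) t = y) /\
                      (orb rho (stab rho s) y #<= `I_M)%card].
Proof.
case=> _ fin.
(* Orbits are nonempty, so size 0, about which the property says nothing, can be left out. *)
have fD : finite_set
    (\bigcup_(n in `I_M.+1) if (0 < n)%N then
       dcosets_of_size (stab rho s) (stab rho t) n else set0).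
  by apply: bigcup_finite => // -[|n] _ //=; exact: fin.
apply: (@sub_finite_set _ _ (\bigcup_(D in _) [set autP (rho z) t | z in D])
  _ (bigcup_finite fD _)); last first.
  move=> D [n _]; case: ifP => // _ [[g ->] _].
  by rewrite orb_double_coset; exact: orb_fin.
move=> _ [[x <-] xM]; exists (double_coset (stab rho s) x (stab rho t)).
  have [n nE] := orb_fin s (autP (rho x) t).
  have n0 : (0 < n)%N.
    case: n nE => //; rewrite II0 card_eq0 => /eqP orb0.
    have : orb rho (stab rho s) (autP (rho x) t) (autP (rho x) t).
      by exists 1%g; rewrite ?act1P //; exact: stab1.
    by rewrite orb0.
  exists n => /=.
    by rewrite ltnS -card_le_II -(card_le_eql nE).
  by rewrite n0; split; [exists x|rewrite (card_eql (left_cosets_orb _ _ _ _))].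
exists x => //; exists 1%g; first exact: stab1.
by exists 1%g; [exact: stab1|rewrite mul1g mulg1].
Qed.

Lemma double_coset_property_ends s t :
  double_coset_property (stab rho s) (stab rho t) ->
  forall e xi, is_end xi -> ~ (stabE rho e `<=` stab_end rho xi).
Proof.
move=> dcp e xi xi_end /(end_fixator T_tree xi_end)[r [i0 [[_ rinj] rfix]]].
(* Pigeonhole: the fixed tail meets some edge orbit infinitely often. *)
have [f0 [A infA Af0]] : exists q, exists2 A : set nat, infinite_set A &
    forall k, A k <-> Defs.piE rho (r (i0 + k)%N) = q.
  apply: finite_range_cst_subsequence.
  exact: sub_finite_set fin_qE.
have [f fE] := piE_onto f0.
have /choice[x xE] k : exists x, A k -> autE (rho x) f = r (i0 + k)%N.
  have [/Af0 Ak|nA] := pselect (A k); last by exists 1%g.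
  by have [y yE] := piE_eq (etrans fE (esym Ak)); exists y.
(* This bound is independent of [k]; the next step parametrises all the orbits of the points [x k]
   applied to [t] by this one product. *)
have [M MP] : exists M,
    (orb rho (stab rho s) (inr e) `*` orb rho (stab rho (inr f)) t #<= `I_M)%card.
  by apply/finite_set_leP/finite_setX; exact: orb_fin.
have small k : A k -> (orb rho (stab rho s) (autP (rho (x k)) t) #<= `I_M)%card.
  move=> Ak; apply: card_le_trans MP.
  have /choice[c cP] a : exists g, orb rho (stab rho s) (inr e) a ->
      stab rho s g /\ autP (rho g) (inr e) = a.
    have [[g gs ge]|na] := pselect (orb rho (stab rho s) (inr e) a).
      by exists g.
    by exists 1%g.
  apply: (@card_le_onto _ _ (fun ab => autP (rho (c ab.1 * x k)%g) ab.2)).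
  move=> _ [g gs <-]; pose a := autP (rho g) (inr e).
  have aS : orb rho (stab rho s) (inr e) a by exists g.
  have [cs ce] := cP _ aS.
  (* [(c a)^-1 * g] fixes [e], hence the tail edge that [x k] makes of [f]; its conjugate [h]
     therefore fixes [f]. *)
  pose h := ((x k)^-1 * ((c a)^-1 * g) * x k)%g.
  exists (a, autP (rho h) t); last first.
    by rewrite /= -!actP /h -!mulgA !mulVKg.
  split=> //=; exists h => //.
  have fixe : stabE rho e ((c a)^-1 * g)%g.
    suff : autP (rho ((c a)^-1 * g)%g) (inr e) = inr e by [].
    by rewrite actP -/a -[X in autP _ X]ce actPK.
  apply: (stabEP _ _ _).2.
  by rewrite /h 2!actE xE // rfix ?leq_addr // -(xE k Ak) actEK.
(* The translates of [f] compatible with [y] form a translate of the orbit of [f] under the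
   stabiliser of [t], so one point [y] accounts for finitely many tail edges only. *)
pose F y := [set z | exists2 x', autP (rho x') t = y & autP (rho x') (inr f) = z].
have finF y : finite_set (F y).
  have [[x' x't]|ny] := pselect (exists x', autP (rho x') t = y); last first.
    apply: (sub_finite_set _ (finite_set0 _)) => z [x' x't _].
    by apply: ny; exists x'.
  apply: sub_finite_set (finite_image (autP (rho x')) (orb_fin t (inr f))).
  move=> _ [z zt <-]; exists (autP (rho (x'^-1 * z)%g) (inr f)).
    by exists (x'^-1 * z)%g; rewrite // /stab /= actP zt -x't actPK.
  by rewrite -actP mulVKg.
apply: infA.
have finY := bigcup_finite (double_coset_property_small_orbits M dcp)
  (fun y _ => finF y).
(* The infinitely many tail edges indexed by [A] are distinct, yet all lie in the finite union
   [finY]. *)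
have injA : {in A &, injective (fun k => inr (r (i0 + k)%N) : gpoint T)}.
  by move=> k l _ _ [] /(congr1 (@org T))/rinj/addnI.
rewrite -(eq_finite_set (inj_card_eq injA)); apply: sub_finite_set finY.
move=> _ [k Ak <-]; exists (autP (rho (x k)) t).
  by split; [exists (x k)|exact: small].
by exists (x k); rewrite //= xE.
Qed.
End Necessity.

(** * Moving a geodesic beyond an edge while fixing it up to that edge *)

Section Extension.
Context (G : groupType) (T : sgraph) (rho : {multiplicative G -> gaut T}).
Implicit Types (g h x : G) (s t y : gpoint T) (v w u : vertex T).
Implicit Types (e f : edge T) (p q : seq (edge T)) (L : set (vertex T)).
Hypothesis T_tree : is_tree T.

Lemma dist_aut (f : gaut T) v w : dist (autV f v) (autV f w) = dist v w.
Proof.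
have [p gp <-] := geodesicP T_tree v w.
have gfp := geodesic_aut f gp.
by rewrite -path_end_aut !dist_geodesic // size_map.
Qed.

Lemma geodesic_cat v p q :
  geodesic v (p ++ q) -> geodesic v p /\ geodesic (path_end v p) q.
Proof. by case=> /is_path_cat[pp pq] /reduced_cat[]. Qed.

(** The common consequence of both hypotheses on the action, and all that the orbit growth uses of
    them. *)
Definition extends_fixing : Prop := forall v p e q h,
  geodesic v (rcons p e ++ q) -> stabE rho e h ->
  exists g, [/\ stabV rho v g, map (autE (rho g)) (rcons p e) = rcons p e
              & map (autE (rho g)) q = map (autE (rho h)) q].

Lemma is_path_piE (noinv : without_inversions rho) v p : is_path v p ->
  @is_path (quotient_graph noinv) (piV rho v) (map (Defs.piE rho) p).
Proof.
elim: p v => [//|e p IH] v /= [<- /IH pp]; split.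
  by apply: val_inj; rewrite /= org_orbE.
suff <- : piV rho (tgt e) = qtgt (Defs.piE rho e) by [].
by apply: val_inj; rewrite /= tgt_orbE.
Qed.

(** Continuing [rcons p e] by [q] or by its image under [h] gives two geodesics with the same
    projection; the second is reduced at the junction because [h] fixes [e]. *)
Lemma weakly_locally_infty_transitive_extends (noinv : without_inversions rho) :
  weakly_locally_infty_transitive noinv -> extends_fixing.
Proof.
move=> wlit v p e q h gpq /stabEP he.
have [g gv] : exists2 g, stabV rho v g &
    map (autE (rho g)) (rcons p e ++ q) = rcons p e ++ map (autE (rho h)) q.
  apply: (wlit v (map (Defs.piE rho) (rcons p e ++ q))) => //.
  - by apply: is_path_piE; case: gpq.
  - case: gpq => /is_path_cat[pp pq].
    rewrite cat_rcons => /reduced_cat_cons[rp rq]; split.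
      apply/is_path_cat; split=> //.
      rewrite path_end_rcons -he aut_tgt; apply: is_path_aut.
      by rewrite path_end_rcons in pq.
    rewrite cat_rcons; apply/reduced_cat_cons; split=> //.
    by rewrite -{1}he; exact: (reduced_aut (rho h) rq).
  - rewrite !map_cat -map_comp; congr (_ ++ _).
    by apply: eq_map => f /=; rewrite piE_act.
rewrite map_cat => gE; exists g; split=> //.
  have /(congr1 (take (size (rcons p e)))) := gE.
  by rewrite !take_size_cat // size_map.
have /(congr1 (drop (size (rcons p e)))) := gE.
by rewrite !drop_size_cat // size_map.
Qed.

Lemma proj_fibre_fixator L w u g : line_fixator rho L g -> L w ->
  proj_fibre L w u -> proj_fibre L w (autV (rho g) u).
Proof.
by move=> gL Lw wu x Lx; rewrite -{1}(gL w Lw) -(gL x Lx) !dist_aut; exact: wu.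
Qed.

(* Property (P) for the line with vertices [org e] and [tgt e]: act by [h] beyond
   [e] and trivially behind it. *)
Lemma property_P_extends : property_P rho -> extends_fixing.
Proof.
move=> tits v p e q h gpq /stabEP he.
pose L := [set w | List.In w (org e :: map (@tgt T) [:: e])].
have Lorg : L (org e) by left.
have Ltgt : L (tgt e) by right; left.
have lineL : is_line L by left; exists (org e), [:: e].
(* The two fibres need different indices, so that the prescriptions over them are independent. *)
have te : tgt e <> org e.
  move=> te; suff: [:: e] = [::] by [].
  exact: (reduced_closed_nil T_tree (v := org e)).
pose k w := if pselect (w = tgt e) then h else 1%g.
have kL w : line_fixator rho L (k w).
  move=> u Lu; rewrite /k; case: pselect => [?|?]; last by rewrite act1.
  by case: Lu => [<-|[<-|[]]]; rewrite -?aut_org -?aut_tgt he.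
pose s (w : L) (x : proj_fibre L (val w)) : proj_fibre L (val w) :=
  SigSub (mem_set (proj_fibre_fixator (kL (val w)) (set_valP w) (set_valP x))).
have [|g gL gs] := tits L lineL s; first by move=> w; exists (k (val w)).
have gk w u : L w -> proj_fibre L w u -> autV (rho g) u = autV (rho (k w)) u.
  move=> Lw uw; pose w' : L := SigSub (mem_set Lw).
  pose u' : proj_fibre L (val w') := SigSub (mem_set uw).
  exact: esym (gs w' u').
have [gp gq] := geodesic_cat gpq.
have [gp0 [pe _]] : geodesic v p /\ geodesic (path_end v p) [:: e].
  by apply: geodesic_cat; rewrite cats1.
have {}pe : org e = path_end v p by case: pe.
have geq : geodesic (org e) (e :: q).
  rewrite path_end_rcons in gq; split; first by split=> //; case: gq.
  by case: gpq => _; rewrite cat_rcons => /reduced_cat_cons[].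
rewrite path_end_rcons in gq.
(* Appending [e] to [p] lengthens the geodesic, so [v] projects to [org e], where the prescription
   is trivial. *)
have gv : autV (rho g) v = v.
  rewrite (gk (org e)) //.
    by rewrite /k; case: pselect => [/esym//|?]; rewrite act1.
  have dp : dist v (org e) = size p by rewrite pe dist_geodesic.
  have dpe : dist v (tgt e) = (size p).+1.
    by rewrite -(path_end_rcons v p e) dist_geodesic // size_rcons.
  by move=> u [<-|[<-|[]]]; rewrite dp ?dpe.
(* Symmetrically, the end of [q] projects to [tgt e], where [g] acts as [h]. *)
have gtq : autV (rho g) (path_end (tgt e) q) = autV (rho h) (path_end (tgt e) q).
  rewrite (gk (tgt e)) //; first by rewrite /k; case: pselect.
  have dq : dist (path_end (tgt e) q) (tgt e) = size q.
    by rewrite dist_sym dist_geodesic.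
  have deq : dist (path_end (tgt e) q) (org e) = (size q).+1.
    by rewrite dist_sym -[RHS](dist_geodesic T_tree geq).
  by move=> u [<-|[<-|[]]]; rewrite dq ?deq.
(* Geodesics are determined by their end vertices, so the action on edges follows from that on these
   vertices. *)
exists g; split.
- exact/stabVP.
- by apply: geodesic_fixed gp gv _ => //; rewrite path_end_rcons gL.
- have gt : autV (rho g) (tgt e) = tgt e by exact: gL.
  have ht : autV (rho h) (tgt e) = tgt e by rewrite -aut_tgt he.
  apply: (geodesic_inj T_tree (v := tgt e)).
  + by rewrite -{1}gt; exact: geodesic_aut.
  + by rewrite -{1}ht; exact: geodesic_aut.
  + by rewrite -{1}gt -{2}ht !path_end_aut.
Qed.

End Extension.

(** * König's lemma and the growth of orbits *)

Section Koenig.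
Context (G : groupType) (T : sgraph) (rho : {multiplicative G -> gaut T}).
Implicit Types (g h x : G) (t y : gpoint T) (v w u : vertex T).
Implicit Types (e f : edge T) (p q : seq (edge T)) (r : nat -> edge T).
Hypothesis T_tree : is_tree T.
Hypothesis T_lf : locally_finite T.

(** A repeated origin would close up a nonempty geodesic. *)
Lemma geodesics_ray r :
  (forall n, geodesic (org (r 0%N)) (map r (iota 0 n))) -> is_ray r.
Proof.
move=> gr.
have gsub i k :
    geodesic (path_end (org (r 0%N)) (map r (iota 0 i))) (map r (iota i k)).
  by apply: (geodesic_cat _).2; rewrite -map_cat -iotaD.
have org_r i : path_end (org (r 0%N)) (map r (iota 0 i)) = org (r i).
  by case: (gsub i 1%N) => -[].
split=> [i|].
  by case: (gsub i 2%N) => /= -[_ []].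
suff lt i j : (i < j)%N -> org (r i) <> org (r j).
  by move=> i j ij; case: (ltngtP i j) => // /lt; rewrite ij.
move=> ij rij; have := gsub i (j - i)%N.
rewrite org_r => /(reduced_closed_nil T_tree).
rewrite -{1}(org_r i) -path_end_cat -map_cat -iotaD (subnKC (ltnW ij)) org_r rij.
move=> /(_ erefl) /(congr1 size); rewrite size_map size_iota /=; lia.
Qed.

(** A continuation that the stabiliser of [e] fails to move; condition (iii) is used as a bound on
    the length of these. *)
Definition fixed_extension e q : Prop :=
  geodesic (org e) (e :: q) /\
  forall h, stabE rho e h -> map (autE (rho h)) q = q.

Lemma fixed_extension_prefix e p q :
  fixed_extension e (p ++ q) -> fixed_extension e p.
Proof.
case=> gpq fpq; split; first by have [] := @geodesic_cat _ _ (e :: p) q gpq.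
move=> h /fpq; rewrite map_cat => /(congr1 (take (size p))).
by rewrite !take_size_cat // size_map.
Qed.

Lemma fixed_extension_aut g e q : fixed_extension e q ->
  fixed_extension (autE (rho g) e) (map (autE (rho g)) q).
Proof.
case=> geq feq; split; first by rewrite aut_org; exact: (geodesic_aut (rho g) geq).
move=> h /stabEP hge; rewrite -map_comp.
have /feq qE : stabE rho e (g^-1 * h * g)%g.
  by apply/stabEP; rewrite !actE hge actEK.
rewrite -[in RHS]qE -map_comp; apply: eq_map => f /=.
by rewrite -!actE !mulgA mulgV mul1g.
Qed.

Lemma ray_stab_end e r : is_ray r ->
  (forall h i, stabE rho e h -> autE (rho h) (r i) = r i) ->
  stabE rho e `<=` stab_end rho [set s | is_ray s /\ ray_equiv r s].
Proof.
move=> rr rfix; pose xi := [set s | is_ray s /\ ray_equiv r s].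
have sub h s : stabE rho e h -> xi s -> xi (autE (rho h) \o s).
  move=> eh [rs [m [n mn]]]; split; first exact: ray_aut.
  by exists m, n => k /=; rewrite -mn rfix.
move=> h eh; apply/seteqP; split=> [_ [s xs <-]|s xs]; first exact: sub.
exists (autE (rho h^-1%g) \o s); first by apply: sub xs; exact: stabVg.
by apply: funext => i /=; rewrite actEVK.
Qed.

(** König's lemma: by local finiteness the fixed continuations of [e] contain an infinite branch, a
    ray whose end is stabilised. *)
Lemma unbounded_fixed_extension_end e :
  (forall n, exists q, fixed_extension e q /\ (n <= size q)%N) ->
  exists2 xi, is_end xi & stabE rho e `<=` stab_end rho xi.
Proof.
move=> unb.
(* The invariant carried along the branch. *)
pose ext p := forall n, exists q, fixed_extension e (p ++ q) /\ (n <= size q)%N.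
have /choice[F FP] p : exists f, ext p -> ext (rcons p f).
  have [ep|] := pselect (ext p); last by exists e.
  apply: contrapT => next.
  (* If no next edge kept the invariant, the finitely many candidates would share a bound [N],
     against a prolongation of [p] of length at least [N.+1]. *)
  pose P f n := ~ exists q, fixed_extension e (rcons p f ++ q) /\ (n <= size q)%N.
  have [||N NP] := finite_uniform_bound (P := P) (T_lf (path_end (tgt e) p)).
  - move=> f n m nm nP [q [fq mq]]; apply: nP; exists q; split=> //.
    exact: leq_trans mq.
  - move=> f _; apply: contrapT => nf; apply: next; exists f => _ n.
    by apply: contrapT => nP; apply: nf; exists n.
  have [[|f q] [fq]] // := ep N.+1; rewrite /= ltnS => Nq; apply: (NP f).
    by case: fq => -[/= [_ /is_path_cat[_ []]]].
  by exists q; rewrite cat_rcons.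
pose P_ := fix P_ n := if n is n'.+1 then rcons (P_ n') (F (P_ n')) else [::].
have extP n : ext (P_ n) by elim: n => [|n IH] //=; exact: FP.
have fixP n : fixed_extension e (P_ n).
  by have [q [/fixed_extension_prefix]] := extP n 0%N.
pose r n := if n is n'.+1 then F (P_ n') else e.
have PE n : map r (iota 0 n.+1) = e :: P_ n.
  by elim: n => [//|n IH]; rewrite -addn1 iotaD map_cat IH /= cats1.
have rr : is_ray r.
  apply: geodesics_ray => k; case: k => [|k]; first by split.
  by rewrite PE; case: (fixP k).
exists [set s | is_ray s /\ ray_equiv r s]; first by exists r.
apply: ray_stab_end => // h [|i] eh /=; first exact/stabEP.
have [_ /(_ h eh)] := fixP i.+1.
by rewrite /= map_rcons => /(congr1 (last e)); rewrite !last_rcons.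
Qed.

(** Translating an edge translates its fixed continuations, so one bound per edge orbit suffices. *)
Lemma fixed_extension_bound :
  finite_set [set: qedge rho] ->
  (forall e xi, is_end xi -> ~ (stabE rho e `<=` stab_end rho xi)) ->
  exists N, forall e q, fixed_extension e q -> (size q < N)%N.
Proof.
move=> fin_qE noend.
pose P (x : qedge rho) n := forall e q, Defs.piE rho e = x ->
  fixed_extension e q -> (size q < n)%N.
have [||N NP] := finite_uniform_bound (P := P) fin_qE.
- by move=> x n m nm nP e q ex /(nP _ _ ex) /leq_trans; apply.
- move=> x _; have [e ex] := piE_onto x; apply: contrapT => unb.
  have [n|xi xi_end sub] := @unbounded_fixed_extension_end e; last first.
    exact: noend xi_end sub.
  apply: contrapT => nq; apply: unb; exists n => f q fx fq.
  have [g gf] := piE_eq (etrans fx (esym ex)).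
  rewrite ltnNge; apply/negP => nsq; apply: nq.
  exists (map (autE (rho g)) q); rewrite size_map; split=> //.
  by rewrite -gf; exact: fixed_extension_aut.
- by exists N => e q; exact: (NP (Defs.piE rho e)).
Qed.

(** Each further stretch of [N] edges doubles the number of images: some element fixing everything
    before the stretch moves it. The strict inequality leaves an edge [e] in front of the last
    stretch. *)
Lemma orbit_growth N : extends_fixing rho ->
  (forall e q, fixed_extension e q -> (size q < N)%N) ->
  forall m v p, geodesic v p -> (m * N < size p)%N ->
  exists c : nat -> G, (forall i, stabV rho v (c i)) /\
    forall i j, (i < 2 ^ m)%N -> (j < 2 ^ m)%N ->
      map (autE (rho (c i))) p = map (autE (rho (c j))) p -> i = j.
Proof.
move=> extG bndN; elim=> [|m IH] v p gp sp.
  exists (fun=> 1%g); split=> [i|i j]; first exact: stab1.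
  by rewrite expn0 !ltnS !leqn0 => /eqP -> /eqP ->.
have [p0 [e [q [pE sq mp0]]]] : exists p0 e q,
    [/\ p = rcons p0 e ++ q, size q = N & (m * N < (size p0).+1)%N].
  have := cat_take_drop (size p - N)%N p.
  have : size (drop (size p - N)%N p) = N by rewrite size_drop; lia.
  have : (m * N < size (take (size p - N)%N p))%N.
    by rewrite size_take; case: ifP; lia.
  case/lastP: (take _ p) => [//|p0 e]; rewrite size_rcons => mp0 sq pE.
  by exists p0, e, (drop (size p - N)%N p).
rewrite pE in gp; have [gp1 gq] := geodesic_cat gp.
have [h eh hq] : exists2 h, stabE rho e h & map (autE (rho h)) q <> q.
  apply: contrapT => nh; suff /bndN : fixed_extension e q by rewrite sq ltnn.
  split; last by move=> h eh; apply: contrapT => hq; apply: nh; exists h.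
  rewrite path_end_rcons in gq; split; first by split=> //; case: gq.
  by case: gp => _; rewrite cat_rcons => /reduced_cat_cons[].
have [g [gv gp0 {}hq]] : exists g, [/\ stabV rho v g,
    map (autE (rho g)) (rcons p0 e) = rcons p0 e & map (autE (rho g)) q <> q].
  by have [g [? ? gq']] := extG _ _ _ _ _ gp eh; exists g; rewrite gq'.
have [|c [cv cinj]] := IH v _ gp1; first by rewrite size_rcons.
(* The image of [rcons p0 e] determines [i./2]; the image of [q] then determines the parity, as [g]
   moves [q]. *)
pose d i := if odd i then (c i./2 * g)%g else c i./2.
exists d; split=> [i|i j im jm].
  rewrite /d; case: ifP => _; last exact: cv.
  by apply: (@stabM _ _ _ (inl v)); first exact: cv.
have dE i' : map (autE (rho (d i'))) (rcons p0 e) =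
    map (autE (rho (c i'./2))) (rcons p0 e).
  rewrite /d; case: ifP => // _; rewrite -[in RHS]gp0 -map_comp.
  by apply: eq_map => f /=; rewrite actE.
rewrite pE !map_cat => dij.
have ij2 : i./2 = j./2.
  apply: cinj; [by rewrite expnS in im; lia|by rewrite expnS in jm; lia|].
  rewrite -!dE; have /(congr1 (take (size (rcons p0 e)))) := dij.
  by rewrite !take_size_cat // size_map.
have /(congr1 (drop (size (rcons p0 e)))) := dij.
rewrite !drop_size_cat ?size_map // /d -ij2 => {}dij.
suff oij : odd i = odd j.
  by rewrite -(odd_double_half i) -(odd_double_half j) oij ij2.
have cK q' q'' :
    map (autE (rho (c i./2))) q' = map (autE (rho (c i./2))) q'' -> q' = q''.
  by apply: inj_map; exact: (bij_inj (autE_bij _)).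
have cgE : map (autE (rho (c i./2 * g)%g)) q =
    map (autE (rho (c i./2))) (map (autE (rho g)) q).
  by rewrite -map_comp; apply: eq_map => f /=; rewrite actE.
by move: dij; case: (odd i); case: (odd j) => //; rewrite cgE => /cK // /esym.
Qed.

(** Distinct images of [p] have distinct ends, since a geodesic from [v] is determined by its
    end. *)
Lemma card_orb_growth N : extends_fixing rho ->
  (forall e q, fixed_extension e q -> (size q < N)%N) ->
  forall m v p, geodesic v p -> (m * N < size p)%N ->
  (`I_(2 ^ m) #<= orb rho (stabV rho v) (inl (path_end v p)))%card.
Proof.
move=> extG bndN m v p gp sp; have [c [cv cinj]] := orbit_growth extG bndN gp sp.
apply: (@card_le_inj _ _ (fun i => inl (autV (rho (c i)) (path_end v p)))).
  by move=> i _; exists (c i).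
move=> i j im jm [cij]; apply: cinj => //.
have cvE k : autV (rho (c k)) v = v by apply/stabVP.
have gc k : geodesic v (map (autE (rho (c k))) p).
  by rewrite -{1}(cvE k); exact: geodesic_aut.
apply: (geodesic_inj T_tree (gc i) (gc j)).
by rewrite -{1}(cvE i) -{2}(cvE j) !path_end_aut.
Qed.

End Koenig.

(** * Counting double cosets *)

Section Counting.
Context (G : groupType) (T : sgraph) (rho : {multiplicative G -> gaut T}).
Implicit Types (g h x : G) (s t y : gpoint T) (v w u : vertex T).
Implicit Types (e f : edge T) (p q : seq (edge T)).
Hypothesis T_tree : is_tree T.
Hypothesis T_lf : locally_finite T.
Hypothesis fin_qV : finite_set [set: qvertex rho].
Hypothesis fin_qE : finite_set [set: qedge rho].
Hypothesis T_edge : [set: edge T] !=set0.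

Let orb_fin := orb_finite T_tree T_lf fin_qV T_edge.

(** Passes from the stabiliser of [s], possibly an edge, to the vertex stabiliser containing it, for
    which orbit growth is known; the cost is its index, bounded by [K]. *)
Lemma card_orb_base s y K n :
  (orb rho (stabV rho (base s)) s #<= `I_K)%card ->
  (orb rho (stab rho s) y #<= `I_n)%card ->
  (orb rho (stabV rho (base s)) (inl (base y)) #<= `I_(K * n))%card.
Proof.
move=> sK yn; apply: card_le_trans (card_le_setX sK yn).
have /choice[c cP] a : exists g, orb rho (stabV rho (base s)) s a ->
    autP (rho g) s = a.
  have [[g gs ga]|na] := pselect (orb rho (stabV rho (base s)) s a).
    by exists g.
  by exists 1%g.
apply: (@card_le_onto _ _ (fun ab => inl (base (autP (rho (c ab.1)) ab.2)))).
move=> _ [g gs <-]; pose a := autP (rho g) s.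
have aS : orb rho (stabV rho (base s)) s a by exists g.
exists (a, autP (rho ((c a)^-1 * g)%g) y); last by rewrite /= -actP mulVKg base_aut.
split=> //=; exists ((c a)^-1 * g)%g => //.
suff : autP (rho ((c a)^-1 * g)%g) s = s by [].
by rewrite actP -/a -[X in autP _ X](cP _ aS) actPK.
Qed.

Lemma polynomial_count s t : extends_fixing rho ->
  (forall e xi, is_end xi -> ~ (stabE rho e `<=` stab_end rho xi)) ->
  exists A k, forall n, (0 < n)%N ->
    (dcosets_of_size (stab rho s) (stab rho t) n #<= `I_(A * n ^ k))%card.
Proof.
move=> extG noend.
have [N bndN] := fixed_extension_bound T_tree T_lf fin_qE noend.
have [C cardC] := degree_bound T_lf fin_qV; have [e0 _] := T_edge.
have [K] : exists K, (orb rho (stabV rho (base s)) s #<= `I_K)%card.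
  by apply/finite_set_leP; exact: (orb_fin (inl (base s)) s).
(* [K] is enlarged to be positive, as [trunc_log] needs [K * n] positive. *)
have {}K1 : (`I_K #<= `I_K.+1)%card by rewrite card_le_II.
move=> /card_le_trans /(_ K1) {K1}.
set c := C.+1; move: K.+1 (ltn0Sn K) => {}K K0 cardK.
exists (2 ^ c * (2 * K) ^ (c * N))%N, (c * N)%N => n n0.
(* The least [m] with [K * n < 2 ^ m]: a point further than [m * N] from [base s] would have too
   large an orbit, while [2 ^ m] stays linear in [n]. *)
pose m := (trunc_log 2 (K * n)).+1.
have mlt : (K * n < 2 ^ m)%N by exact: trunc_log_ltn.
have mle : (2 ^ m <= 2 * (K * n))%N.
  by rewrite expnS leq_mul2l trunc_logP // muln_gt0 K0.
have near y : (orb rho (stab rho s) y #<= `I_n)%card ->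
    graph_ball (base s) (m * N) (base y).
  move=> yn; have [p gp pe] := geodesicP T_tree (base s) (base y).
  exists p; split=> //; first by case: gp.
  rewrite leqNgt; apply/negP => mp.
  have := card_orb_growth T_tree extG bndN gp mp; rewrite pe => big.
  have := card_le_trans big (card_orb_base cardK yn).
  by rewrite card_le_II leqNgt mlt.
(* Bound [c] by [2 ^ c], rewrite the power as one of [2 ^ m], and apply [mle]; this gives the
   constants chosen above. *)
have leA : (C.+1 ^ (m * N).+1 <= 2 ^ c * (2 * K) ^ (c * N) * n ^ (c * N))%N.
  rewrite -mulnA -expnMn -mulnA (@leq_trans ((2 ^ c) ^ (m * N).+1)) //.
    by rewrite leq_exp2r // ltnW // ltn_expl.
  rewrite expnS leq_mul2l; apply/orP; right.
  rewrite -expnM (mulnCA c m) expnM.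
  by case: (posnP (c * N)) => [->//|cN]; rewrite leq_exp2r.
apply: (@card_le_trans _ _ _ `I_(C.+1 ^ (m * N).+1)); last by rewrite card_le_II.
apply: card_le_trans (card_points e0 cardC (base s) (m * N)).
apply: (@card_le_onto _ _
  (fun y => [set z | orb rho (stab rho s) y (autP (rho z) t)])).
move=> _ [[g ->] gn]; exists (autP (rho g) t); last by rewrite double_cosetE.
apply: near; rewrite -(card_le_eql (left_cosets_orb _ _ _ _)).
by rewrite (card_le_eql gn).
Qed.

Lemma polynomial_growth (R : realType) s t : extends_fixing rho ->
  (forall e xi, is_end xi -> ~ (stabE rho e `<=` stab_end rho xi)) ->
  polynomial_double_coset_growth R (stab rho s) (stab rho t).
Proof.
move=> extG /(polynomial_count s t extG)[A [k cnt]]; split.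
  split=> [g|n /cnt n0]; last by apply/finite_set_leP; exists (A * n ^ k)%N.
  by rewrite (eq_finite_set (left_cosets_orb _ _ _ _)).
exists k%:R%R => //; apply/eqOP.
(* Any constant [C] from [A] on works for all positive [n]. *)
near=> C; near=> n.
have n0 : (0 < n)%N by near: n; exact: nbhs_infty_gt.
have := geq_card_fset_set (cnt n n0); rewrite -/(dcoset_count _ _ _) => le.
rewrite normr_nat powR_mulrn ?ler0n // ger0_norm ?exprn_ge0 //.
rewrite (@le_trans _ _ (A%:R * n%:R ^+ k)%R) //.
  by rewrite -natrX -natrM ler_nat.
rewrite ler_wpM2r ?exprn_ge0 //; near: C; exact: nbhs_pinfty_ge.
Unshelve. all: by end_near. Qed.

End Counting.

Theorem theoremA (R : realType) (G : topologicalGroupType) (T : sgraph)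
    (rho : {multiplicative G -> gaut T})
    (rho_cont : continuous rho)
    (T_tree : is_tree T)
    (T_lf : locally_finite T)
    (noinv : without_inversions rho)
    (T_edge : [set: edge T] !=set0)
    (T_stabs : adjacent_stabs_incomparable rho)
    (T_cofinite : finite_graph (quotient_graph noinv))
    (T_action : weakly_locally_infty_transitive noinv \/ P_closed rho)
    (t1 t2 : gpoint T) :
  [<-> double_coset_property (stab rho t1) (stab rho t2);
       polynomial_double_coset_growth R (stab rho t1) (stab rho t2);
       forall e : edge T, forall xi : set (nat -> edge T), is_end xi ->
         ~ (stabE rho e `<=` stab_end rho xi)].
Proof.
have [fin_qV fin_qE] := T_cofinite.
have noend : double_coset_property (stab rho t1) (stab rho t2) ->
    forall e xi, is_end xi -> ~ (stabE rho e `<=` stab_end rho xi).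
  exact: double_coset_property_ends.
have growth : (forall e xi, is_end xi -> ~ (stabE rho e `<=` stab_end rho xi)) ->
    polynomial_double_coset_growth R (stab rho t1) (stab rho t2).
  apply: polynomial_growth => //; case: T_action => [|[_ _]].
    exact: weakly_locally_infty_transitive_extends.
  exact: property_P_extends.
(* Polynomial growth contains the double-coset property by definition, so [noend] and [growth] close
   the cycle. *)
tfae; [by move/noend|by case=> /noend|by case/growth].
Qed.
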